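(* Let $A\in\mathbb{C}_{n,n}$ with $\mathrm{Ind}(A)=k$. Then the WG inverse of $A$ satisfies $$A^{(W)}=A^k\left(A^{k+2}\right)^{(\#)}A=\left(A^2P_{A^k}\right)^{\dag}A .$$
   Context: $\mathbb{C}_{m,n}$ is the set of complex $m\times n$ matrices, $A^\ast$ the conjugate transpose, $\mathcal{R}(\cdot)$ the column space, and $M^\dag$ the Moore-Penrose inverse of $M$. $P_{A^k}=A^k(A^k)^\dag$ is the orthogonal projector onto $\mathcal{R}(A^k)$. The index $\mathrm{Ind}(A)$ is the smallest positive integer $k$ with $\mathrm{rk}(A^{k+1})=\mathrm{rk}(A^k)$. For a matrix $M$ of index one, the core inverse $M^{(\#)}$ is the unique $X$ with $MX=MM^\dag$ and $\mathcal{R}(X)\subseteq\mathcal{R}(M)$. Core-EP decomposition (known): every $A\in\mathbb{C}_{n,n}$ with $\mathrm{Ind}(A)=k$ can be written uniquely as $A=A_1+A_2$ with $\mathrm{Ind}(A_1)=1$, $A_2^k=0$ and $A_1^\ast A_2=A_2A_1=0$, and there is a unitary $U$ with $A_1=U\begin{bmatrix}T&S\\0&0\end{bmatrix}U^\ast$, $A_2=U\begin{bmatrix}0&0\\0&N\end{bmatrix}U^\ast$, $T$ non-singular, $N$ nilpotent (blocks may be empty). The core-EP inverse of $A$ is $A^{(\dag)}=U\begin{bmatrix}T^{-1}&0\\0&0\end{bmatrix}U^\ast$ (independent of the choice of $U$). The WG (weak group) inverse $A^{(W)}$ of $A$ is the unique $X\in\mathbb{C}_{n,n}$ satisfying $AX^2=X$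 and $AX=A^{(\dag)}A$. *)

(* Defs.v *)
From mathcomp Require Import all_boot all_order all_algebra.
From mathcomp Require Import boolp classical_sets.

Set Implicit Arguments.
Unset Strict Implicit.
Unset Printing Implicit Defensive.

Import Order.TTheory GRing.Theory Num.Theory.
Local Open Scope ring_scope.
Local Open Scope classical_set_scope.
Local Open Scope sesquilinear_scope.

Lemma mxindex_ex (F : fieldType) (n : nat) (A : 'M[F]_n) :
  exists k, (0 < k)%N && (\rank (A ^+ k.+1) == \rank (A ^+ k)).
Proof.
suff H m j : (0 < j)%N -> (\rank (A ^+ j) <= m)%N ->
    exists k, (0 < k)%N && (\rank (A ^+ k.+1) == \rank (A ^+ k)).
  exact: (H _ 1%N isT (leqnn _)).
have dec j' : (\rank (A ^+ j'.+1) <= \rank (A ^+ j'))%N.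
  by rewrite exprSr -mulmxE mxrankM_maxl.
elim: m j => [|m IHm] j j_gt0 rj.
  exists j; rewrite j_gt0 eqn_leq dec /=.
  by move: rj; rewrite leqn0 => /eqP ->.
have [e|ne] := eqVneq (\rank (A ^+ j.+1)) (\rank (A ^+ j)).
  by exists j; rewrite j_gt0 e eqxx.
apply: (IHm j.+1) => //; rewrite -ltnS (leq_trans _ rj) //.
by rewrite ltn_neqAle ne dec.
Qed.

Definition mxindex (F : fieldType) (n : nat) (A : 'M[F]_n) : nat :=
  ex_minn (mxindex_ex A).

Section GeneralizedInverses.
Variable C : numClosedFieldType.

Definition is_mpinv (m n : nat) (M : 'M[C]_(m, n)) (X : 'M[C]_(n, m)) : Prop :=
  [/\ M *m X *m M = M, X *m M *m X = X,
      (M *m X)^t* = M *m X & (X *m M)^t* = X *m M].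

Definition mpinv (m n : nat) (M : 'M[C]_(m, n)) : 'M[C]_(n, m) :=
  xget 0 [set X | is_mpinv M X].

(* Row spaces are primitive in MathComp, so the inclusion of column spaces
   R(X) <= R(M) is expressed on transposes. *)
Definition is_coreinv (n : nat) (M X : 'M[C]_n) : Prop :=
  M *m X = M *m mpinv M /\ (X^T <= M^T)%MS.

(* Only meaningful when mxindex M = 1 (junk value 0 otherwise);
   see coreinvP and coreinv_unique. *)
Definition coreinv (n : nat) (M : 'M[C]_n) : 'M[C]_n :=
  xget 0 [set X | is_coreinv M X].

Definition is_core_EP_decomp (n : nat) (A A1 A2 : 'M[C]_n) : Prop :=
  [/\ A = A1 + A2, mxindex A1 = 1%N, A2 ^+ mxindex A = 0,
      A1^t* *m A2 = 0 & A2 *m A1 = 0].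

(* U is a square unitary matrix: its width is written r + s, with r + s = n,
   so that it can be multiplied with block matrices without casts. Either
   block size may be 0. *)
Definition is_core_EPinv (n : nat) (A X : 'M[C]_n) : Prop :=
  exists (r s : nat) (U : 'M[C]_(n, r + s)) (T : 'M[C]_r) (S : 'M[C]_(r, s))
         (N : 'M[C]_s),
    [/\ (r + s)%N = n, U \is unitarymx, T \in unitmx, exists p, N ^+ p = 0 &
        is_core_EP_decomp A (U *m block_mx T S 0 0 *m U^t*)
                            (U *m block_mx 0 0 0 N *m U^t*) /\
        X = U *m block_mx (invmx T) 0 0 0 *m U^t*].

Definition core_EPinv (n : nat) (A : 'M[C]_n) : 'M[C]_n :=
  xget 0 [set X | is_core_EPinv A X].

Definition is_wginv (n : nat) (A X : 'M[C]_n) : Prop :=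
  A *m X ^+ 2 = X /\ A *m X = core_EPinv A *m A.

Definition wginv (n : nat) (A : 'M[C]_n) : 'M[C]_n :=
  xget 0 [set X | is_wginv A X].

(* Existence and uniqueness of all the inverses above, so that the default
   value of xget is never used (for coreinv: provided mxindex M = 1, which
   holds in particular for powers A ^+ j with mxindex A <= j, see
   mxindex_exp). *)

Let ctM m n p (A : 'M[C]_(m, n)) (B : 'M[C]_(n, p)) :
  (A *m B)^t* = B^t* *m A^t*.
Proof. by rewrite trmx_mul map_mxM. Qed.

Lemma gram_unit m n (G : 'M[C]_(m, n)) : row_free G -> G *m G^t* \in unitmx.
Proof.
move=> Gfree; rewrite -row_free_unit -kermx_eq0; apply/rowV0P => v /sub_kermxP.
move=> vGG; apply/eqP; rewrite -(mulmx_free_eq0 v Gfree) -(dnorm_eq0 (@dotmx C n)).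
rewrite -[X in X == 0]/(dotmx (v *m G) (v *m G)).
by rewrite dotmxE ctM mulmxA -(mulmxA v) vGG mul0mx mxE.
Qed.

Lemma mpinvP m n (M : 'M[C]_(m, n)) : is_mpinv M (mpinv M).
Proof.
apply: (@xgetPex _ _ [set X | is_mpinv M X]).
pose F := col_base M; pose G := row_base M.
have eM : F *m G = M by exact: mulmx_base.
have uG : G *m G^t* \in unitmx by apply/gram_unit/row_base_free.
have uF : F^t* *m F \in unitmx.
  have /gram_unit : row_free (F^t*).
    by rewrite /row_free mxrank_map mxrank_tr; exact: col_base_full.
  by rewrite trmxCK.
clearbody F G.
set iG := invmx (G *m G^t*); set iF := invmx (F^t* *m F).
have KG p (Y : 'M_(_, p)) : G *m (G^t* *m (iG *m Y)) = Y.
  by rewrite (mulmxA G) (mulmxA _ iG) mulmxV // mul1mx.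
have KF p (Y : 'M_(_, p)) : iF *m (F^t* *m (F *m Y)) = Y.
  by rewrite (mulmxA (F^t*)) (mulmxA iF) mulVmx // mul1mx.
have hiG : iG^t* = iG.
  by rewrite /iG trmx_inv map_invmx ctM trmxCK.
have hiF : iF^t* = iF.
  by rewrite /iF trmx_inv map_invmx ctM trmxCK.
pose Z := G^t* *m (iG *m (iF *m F^t*)).
suff HZ : is_mpinv (F *m G) Z by exists Z; rewrite eM in HZ.
rewrite /Z; split.
- by rewrite -!mulmxA KG KF.
- by rewrite -!mulmxA KF KG.
- by rewrite -!mulmxA KG !ctM trmxCK hiF !mulmxA.
- by rewrite -!mulmxA KF !ctM trmxCK hiG !mulmxA.
Qed.

Lemma mpinv_unique m n (M : 'M[C]_(m, n)) (X : 'M[C]_(n, m)) :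
  is_mpinv M X -> X = mpinv M.
Proof.
move=> [a1 a2 a3 a4]; have [b1 b2 b3 b4] := mpinvP M.
set Y := mpinv M in b1 b2 b3 b4 *.
have e1 : M *m X = M *m Y.
  by rewrite -{1}b1 -(mulmxA _ M X) -b3 -a3 -ctM (mulmxA _ M Y) a1 b3.
have e2 : X *m M = Y *m M.
  by rewrite -{1}b1 -(mulmxA M) mulmxA -a4 -b4 -ctM -(mulmxA Y) (mulmxA M) a1 b4.
by rewrite -a2 -mulmxA e1 mulmxA e2 b2.
Qed.

Section Core.
Variables (n : nat) (M : 'M[C]_n).
Hypothesis M_index1 : mxindex M = 1%N.

Let rankM2 : \rank (M *m M) = \rank M.
Proof.
move: M_index1; rewrite /mxindex; case: ex_minnP => k + _ ek.
by rewrite ek expr2 expr1 -mulmxE => /eqP.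
Qed.

Lemma coreinvP : is_coreinv M (coreinv M).
Proof.
apply: (@xgetPex _ _ [set X | is_coreinv M X]) => /=.
have sMM : ((M *m M)^T <= M^T)%MS by rewrite trmx_mul submxMl.
have /submxP[D eD] : ((M *m mpinv M)^T <= (M *m M)^T)%MS.
  apply: submx_trans (_ : (M^T <= _)%MS); first by rewrite trmx_mul submxMl.
  by rewrite -(geq_leqif (mxrank_leqif_sup sMM)) !mxrank_tr rankM2.
exists (M *m D^T); split; last by rewrite trmx_mul submxMl.
by rewrite mulmxA; apply: trmx_inj; rewrite eD trmx_mul trmxK.
Qed.

Lemma coreinv_unique (X : 'M[C]_n) : is_coreinv M X -> X = coreinv M.
Proof.
have [e2 s2] := coreinvP => -[e1 s1].
apply/eqP; rewrite -subr_eq0; set Z := X - _.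
have /submxP[D eD] : (Z^T <= M^T)%MS.
  by rewrite /Z linearB /= addmx_sub // eqmx_opp.
have MZ : M *m Z = 0 by rewrite mulmxBr e1 e2 subrr.
have DMM : D *m M^T *m M^T = 0 by rewrite -eD -trmx_mul MZ trmx0.
have /submxP[E eE] : (M <= M *m M)%MS.
  by rewrite -(geq_leqif (mxrank_leqif_sup (submxMl _ _))) rankM2.
by rewrite -trmx_eq0 eD {1}eE !trmx_mul !mulmxA DMM mul0mx.
Qed.
End Core.

Section CoreEP.
Variables (n : nat) (A : 'M[C]_n).
Let k := mxindex A.

Let rankAk : \rank (A ^+ k.+1) = \rank (A ^+ k).
Proof. by rewrite /k /mxindex; case: ex_minnP => j /andP[_ /eqP]. Qed.

Let k_gt0 : (0 < k)%N.
Proof. by rewrite /k /mxindex; case: ex_minnP => j /andP[]. Qed.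

Let mxindex1 (M : 'M[C]_n) : \rank (M *m M) = \rank M -> mxindex M = 1%N.
Proof.
move=> rM; rewrite /mxindex; case: ex_minnP => j /andP[j_gt0 _] j_min.
by apply/eqP; rewrite eqn_leq j_gt0 j_min // expr2 expr1 -mulmxE rM eqxx.
Qed.

Let unitary_invl m p (U : 'M[C]_(m, p)) :
  p = m -> U \is unitarymx -> U^t* *m U = 1%:M.
Proof.
by move=> e; move: U; rewrite e => U /unitarymxP /mulmx1C.
Qed.

Let block_zpow r s (N : 'M[C]_s) j : (0 < j)%N ->
  (block_mx 0 0 0 N : 'M[C]_(r + s)) ^+ j = block_mx 0 0 0 (N ^+ j).
Proof.
elim: j => // -[|j] IHj _; first by rewrite !expr1.
rewrite exprS IHj // -mulmxE mulmx_block !(mulmx0, mul0mx, add0r, addr0).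
by rewrite mulmxE -exprS.
Qed.

Let conj_pow p (U : 'M[C]_(n, p)) (W : 'M[C]_(p, n)) (B : 'M[C]_p) j :
  W *m U = 1%:M -> (0 < j)%N -> (U *m B *m W) ^+ j = U *m B ^+ j *m W.
Proof.
move=> WU; elim: j => // -[|j] IHj _; first by rewrite !expr1.
rewrite exprS IHj // -mulmxE -!mulmxA (mulmxA W) WU mul1mx.
by rewrite (mulmxA B) mulmxE -exprS.
Qed.

Lemma rank_exp_mxindex j : \rank (A ^+ (k + j)) = \rank (A ^+ k).
Proof.
have /submxP[D eD] : (A ^+ k <= A ^+ k.+1)%MS.
  have s1 : (A ^+ k.+1 <= A ^+ k)%MS by rewrite exprS -mulmxE submxMl.
  by rewrite -(geq_leqif (mxrank_leqif_sup s1)) rankAk.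
have eDj : A ^+ k = D ^+ j *m A ^+ (k + j).
  elim: j => [|j IHj]; first by rewrite expr0 mul1mx addn0.
  have e : A ^+ (k + j) = D *m A ^+ (k + j.+1).
    by rewrite addnS -addSn !exprD -!mulmxE mulmxA -eD.
  by rewrite {1}IHj {1}e mulmxA exprSr.
apply/eqP; rewrite eqn_leq {2}eDj mxrankM_maxr addnC exprD -mulmxE.
by rewrite mxrankM_maxr.
Qed.

Lemma mxindex_exp j : mxindex (A ^+ (k + j)) = 1%N.
Proof.
by apply: mxindex1; rewrite mulmxE -exprD -addnA !rank_exp_mxindex.
Qed.

Lemma core_EPinv_ex : exists X, is_core_EPinv A X.
Proof.
have [r [s [W1 [W2 [er ern uW sW1 W2A]]]]] :
    exists r s (W1 : 'M[C]_(r, n)) (W2 : 'M[C]_(s, n)),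
    [/\ r = \rank (A ^+ k), (r + s)%N = n, col_mx W1 W2 \is unitarymx,
        (W1 <= (A ^+ k)^t*)%MS & W2 *m A ^+ k = 0].
  set V := (A ^+ k)^t*.
  pose Vo := orthomx Num.conj (mx_of_hermitian (hermitian1mx _)) V.
  exists (\rank V), (\rank Vo), (schmidt (row_base V)), (schmidt (row_base Vo)).
  have sW2 : (schmidt (row_base Vo) <= Vo)%MS.
    by rewrite eqmx_schmidt_free ?row_base_free // eq_row_base.
  split.
  - by rewrite mxrank_map mxrank_tr.
  - exact: add_rank_ortho.
  - exact: schmidt_complete_unitarymx.
  - by rewrite eqmx_schmidt_free ?row_base_free // eq_row_base.
  - by move/orthomx1P: sW2; rewrite /V trmxCK.
pose U1 := W1^t*; pose U2 := W2^t*.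
have eU : (col_mx W1 W2)^t* = row_mx U1 U2 by rewrite tr_col_mx map_row_mx.
have eUt : (row_mx U1 U2)^t* = col_mx W1 W2 by rewrite -eU trmxCK.
have WU : col_mx W1 W2 *m row_mx U1 U2 = 1%:M by rewrite -eU; apply/unitarymxP.
have UW : row_mx U1 U2 *m col_mx W1 W2 = 1%:M.
  by rewrite -eU; exact: unitary_invl.
have [W11 W12 W21 W22] : [/\ W1 *m U1 = 1%:M, W1 *m U2 = 0,
    W2 *m U1 = 0 & W2 *m U2 = 1%:M].
  by move: WU; rewrite mul_col_row scalar_mx_block => /eq_block_mx.
rewrite mul_row_col in UW.
have [Z eZ] : exists Z, U1 = A ^+ k *m Z.
  have /submxP[D eD] := sW1; exists (D^t*).
  by rewrite /U1 eD ctM trmxCK.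
have W2AU1 : W2 *m A *m U1 = 0.
  rewrite eZ mulmxA -(mulmxA W2) mulmxE -exprS exprSr -mulmxE !mulmxA W2A.
  by rewrite !mul0mx.
pose T := W1 *m A *m U1; pose S := W1 *m A *m U2; pose N := W2 *m A *m U2.
have AU1 : A *m U1 = U1 *m T.
  by rewrite -[LHS]mul1mx -UW mulmxDl -!mulmxA (mulmxA W2) W2AU1 mulmx0 addr0 /T !mulmxA.
have eAk : A ^+ k = U1 *m (W1 *m A ^+ k).
  by rewrite -[LHS]mul1mx -UW mulmxDl -!mulmxA W2A mulmx0 addr0.
have uT : T \in unitmx.
  rewrite -row_free_unit /row_free eqn_leq rank_leq_row /=.
  rewrite [X in (X <= _)%N]er -rankAk exprS -mulmxE.
  have -> : A *m A ^+ k = U1 *m T *m (W1 *m A ^+ k).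
    by rewrite -AU1 -(mulmxA A) -eAk.
  by rewrite -(mulmxA U1) (leq_trans (mxrankM_maxr _ _)) // mxrankM_maxl.
have W2AN : W2 *m A = N *m W2.
  by rewrite -[LHS]mulmx1 -UW mulmxDr !mulmxA W2AU1 mul0mx add0r.
have W2Aj j : W2 *m A ^+ j = N ^+ j *m W2.
  elim: j => [|j IHj]; first by rewrite !expr0 mulmx1 mul1mx.
  rewrite exprSr -mulmxE mulmxA IHj -mulmxA W2AN mulmxA.
  by rewrite exprSr -mulmxE.
have Nk : N ^+ k = 0.
  by rewrite -[LHS]mulmx1 -W22 mulmxA -W2Aj W2A mul0mx.
have eWAU : col_mx W1 W2 *m A *m row_mx U1 U2 = block_mx T S 0 N.
  by rewrite mul_col_mx mul_col_row W2AU1.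
clearbody T S N.
exists (row_mx U1 U2 *m block_mx (invmx T) 0 0 0 *m (row_mx U1 U2)^t*).
exists r, s, (row_mx U1 U2), T, S, N; split=> //.
- by apply/unitarymxP; rewrite eUt mul_row_col.
- by exists k.
split=> //; rewrite eUt; split.
- rewrite -mulmxDl -mulmxDr add_block_mx !(addr0, add0r).
  rewrite -eWAU -!mulmxA mul_row_col UW mulmx1 (mulmxA (row_mx _ _)).
  by rewrite mul_row_col UW mul1mx.
- apply: mxindex1; apply/eqP; rewrite eqn_leq mxrankM_maxl /=.
  set B := block_mx T S 0 0; set U := row_mx U1 U2; set W := col_mx W1 W2.
  have eB : B = block_mx (invmx T) 0 0 0 *m (B *m B).
    rewrite /B !mulmx_block !(mulmx0, mul0mx, add0r, addr0).
    by rewrite !mulmxA mulVmx // !mul1mx.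
  have -> : U *m B *m W *m (U *m B *m W) = U *m (B *m B) *m W.
    by rewrite -!mulmxA (mulmxA W U) WU mul1mx.
  have {1}-> : U *m B *m W = U *m block_mx (invmx T) 0 0 0 *m W *m
      (U *m (B *m B) *m W).
    by rewrite -!mulmxA (mulmxA W U) WU mul1mx {1}eB !mulmxA.
  exact: mxrankM_maxr.
- by rewrite conj_pow // block_zpow // Nk block_mx0 mulmx0 mul0mx.
- rewrite !ctM -[(col_mx W1 W2)^t*]/(_) eU eUt.
  rewrite -!mulmxA (mulmxA (col_mx W1 W2)) WU mul1mx (mulmxA (_ ^t*)).
  rewrite tr_block_mx map_block_mx mulmx_block !(trmx0, map_mx0).
  by rewrite !(mulmx0, mul0mx, add0r, addr0) block_mx0 mul0mx mulmx0.
- rewrite -!mulmxA (mulmxA (col_mx W1 W2)) WU mul1mx (mulmxA (block_mx _ _ _ N)).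
  rewrite mulmx_block !(mulmx0, mul0mx, add0r, addr0) block_mx0.
  by rewrite mul0mx mulmx0.
Qed.

Lemma is_core_EPinv_eqs X : is_core_EPinv A X ->
  [/\ X *m A ^+ k.+1 = A ^+ k, A *m (X *m X) = X & (A *m X)^t* = A *m X].
Proof.
move=> [r [s [U [T [S [N [ern uU uT _ [[eA _ A2k _ _] ->]]]]]]]].
set A2 := (_ *m block_mx 0 0 0 N *m _) in eA A2k.
rewrite -mulmxDl -mulmxDr add_block_mx !(addr0, add0r) in eA.
have UV : U *m U^t* = 1%:M by apply/unitarymxP.
have VU := unitary_invl ern uU.
set V := U^t* in eA UV VU *.
have Nk : N ^+ k = 0.
  move: A2k; rewrite conj_pow // block_zpow // => /(congr1 (mulmx V)).
  move=> /(congr1 (mulmx^~ U)) /=; rewrite mulmx0 mul0mx !mulmxA VU mul1mx.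
  rewrite -mulmxA VU mulmx1 -[0 in RHS](block_mx0 _ r s r s).
  by case/eq_block_mx.
have dVAj j : dsubmx (V *m A ^+ j) = N ^+ j *m dsubmx V.
  rewrite -!mul_dsub_mx; elim: j => [|j IHj]; first by rewrite !expr0 mulmx1 mul1mx.
  rewrite exprSr -mulmxE mulmxA IHj exprSr -mulmxE -!mulmxA; congr (_ *m _).
  rewrite mul_dsub_mx {1}eA !mulmxA VU mul1mx.
  by rewrite -[V in LHS]vsubmxK mul_block_col col_mxKd mul0mx add0r.
have dV : dsubmx (V *m A ^+ k) = 0 by rewrite dVAj Nk mul0mx.
have AX : A *m (U *m block_mx (invmx T) 0 0 0 *m V) = U *m block_mx 1%:M 0 0 0 *m V.
  rewrite {1}eA -!mulmxA (mulmxA V U) VU mul1mx (mulmxA (block_mx _ _ _ _)).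
  rewrite mulmx_block !(mulmx0, mul0mx, add0r, addr0) mulmxV //.
split.
- rewrite exprS -mulmxE {1}eA -!mulmxA (mulmxA V U) VU mul1mx.
  rewrite (mulmxA (block_mx _ _ _ _)).
  rewrite mulmx_block !(mulmx0, mul0mx, add0r, addr0) mulVmx //.
  rewrite -[V *m _]vsubmxK dV mul_block_col !(mulmx0, mul0mx, add0r, addr0) mul1mx.
  have -> : col_mx (usubmx (V *m A ^+ k)) 0 = V *m A ^+ k by rewrite -dV vsubmxK.
  by rewrite mulmxA UV mul1mx.
- rewrite mulmxA AX -!mulmxA (mulmxA V U) VU mul1mx (mulmxA (block_mx _ _ _ _)).
  by rewrite mulmx_block !(mulmx0, mul0mx, add0r, addr0) mul1mx.
- rewrite AX !ctM trmxCK mulmxA; congr (_ *m _ *m _).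
  by rewrite tr_block_mx map_block_mx !(trmx0, map_mx0) trmx1 map_mx1.
Qed.

Lemma core_EPinvP : is_core_EPinv A (core_EPinv A).
Proof. exact: (@xgetPex _ _ [set X | is_core_EPinv A X] core_EPinv_ex). Qed.

Let pow_inv X j : A *m (X *m X) = X -> A ^+ j *m X ^+ j.+1 = X.
Proof.
move=> eX; elim: j => [|j IHj]; first by rewrite expr0 mul1mx expr1.
rewrite exprSr 2!(exprS X) -!mulmxE -!mulmxA (mulmxA X X) (mulmxA A) eX.
by rewrite mulmxE -exprS -mulmxE IHj.
Qed.

Let inv_id Z Z' : Z *m A ^+ k.+1 = A ^+ k -> A *m (Z' *m Z') = Z' ->
  Z *m (A *m Z') = Z'.
Proof.
move=> z1 z2; have eS : A *m A ^+ k = A ^+ k.+1 by rewrite exprS.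
by rewrite -[in LHS](pow_inv k z2) (mulmxA A) eS mulmxA z1 pow_inv.
Qed.

Lemma core_EPinv_unique X : is_core_EPinv A X -> X = core_EPinv A.
Proof.
move=> /is_core_EPinv_eqs[x1 x2 x3].
have [y1 y2 y3] := is_core_EPinv_eqs core_EPinvP.
set Y := core_EPinv A in y1 y2 y3 *.
have PP Z Z' : Z *m A ^+ k.+1 = A ^+ k -> A *m (Z' *m Z') = Z' ->
    (A *m Z) *m (A *m Z') = A *m Z'.
  by move=> z1 z2; rewrite -mulmxA inv_id.
have eP : A *m X = A *m Y.
  by rewrite -x3 -(PP _ _ y1 x2) ctM x3 y3 PP.
by rewrite -(inv_id x1 x2) eP inv_id.
Qed.

Lemma wginvP : is_wginv A (wginv A).
Proof.
have [e1 e2 _] := is_core_EPinv_eqs core_EPinvP.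
apply: (@xgetPex _ _ [set X | is_wginv A X]).
set E := core_EPinv A in e1 e2 *.
have EAE : E *m (A *m E) = E by exact: inv_id.
have AX : A *m (E *m E *m A) = E *m A by rewrite mulmxA e2.
exists (E *m E *m A); split; last exact: AX.
by rewrite expr2 -mulmxE mulmxA AX -!mulmxA (mulmxA A) (mulmxA E (A *m E)) EAE.
Qed.

Lemma wginv_unique X : is_wginv A X -> X = wginv A.
Proof.
have [e1 _ _] := is_core_EPinv_eqs core_EPinvP.
have H Z : is_wginv A Z -> Z = core_EPinv A *m (core_EPinv A *m A).
  move=> [z1 z2]; rewrite -z2.
  have {}z1 : A *m (Z *m Z) = Z by move: z1; rewrite expr2.
  by rewrite inv_id.
by move=> /H ->; rewrite -(H _ wginvP).
Qed.

End CoreEP.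
End GeneralizedInverses.

(* Main.v *)
Require Import Defs.
From mathcomp Require Import all_boot all_order all_algebra.
From mathcomp Require Import reals complex.
Set Implicit Arguments.
Unset Strict Implicit.
Unset Printing Implicit Defensive.
Local Open Scope ring_scope.

(** Write [E] for the core-EP inverse of [A] and [k] for the index of [A].
    The identities [E A^(k+1) = A^k], [A E^2 = E] and [(A E)^* = A E] of
    [is_core_EPinv_eqs] reduce the theorem to word manipulations in [A] and
    [E].

    Iterating the second identity gives [A^j E^(j+1) = E], so [E] factors
    through [A^j] for every [j]; the first says that [E] undoes a left
    multiplication by [A] on the column space of [A^k]. Hence the WG inverse
    is [E^2 A] ([wginvE]), and [A E], which is Hermitian, is the orthogonal
    projector onto the column space of [A^j] for each [j >= k]
    ([mul_mpinv_exp]). In particular [P_(A^k) = A E].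

    Both formulas then follow by recognising a generalized inverse through its
    defining equations: the core inverse of [A^(k+2)] is [E^(k+2)], and
    [A^k E^(k+2) = E^2]; the Moore-Penrose inverse of [A^2 P_(A^k) = A^3 E]
    is [E^2] itself. *)

Import GRing.Theory.
Local Open Scope sesquilinear_scope.

(** An orthogonal projector is determined by its range: [M *m Y] and
    [M *m mpinv M] absorb each other, hence agree after taking adjoints. *)
Lemma mulmx_mpinv_proj (C : numClosedFieldType) m n (M : 'M[C]_(m, n))
    (Y : 'M[C]_(n, m)) :
  (M *m Y)^t* = M *m Y -> M *m Y *m M = M -> M *m mpinv M = M *m Y.
Proof.
move=> hermQ QM; have [PM _ hermP _] := mpinvP M.
rewrite -hermQ -[in RHS]PM -(mulmxA (M *m mpinv M)) trmx_mul map_mxM.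
by rewrite hermQ hermP mulmxA QM.
Qed.

Section Words.
Variables (S : pzSemiRingType) (A E : S) (k : nat).
Hypotheses (EAkS : E * A ^+ k.+1 = A ^+ k) (AEE : A * (E * E) = E).

Lemma exp_mul_expS j : A ^+ j * E ^+ j.+1 = E.
Proof.
elim: j => [|j IHj]; first by rewrite mul1r expr1.
by rewrite exprSr 2!(exprS E) -mulrA (mulrA E) (mulrA A) AEE -exprS.
Qed.

Lemma expS_mul_expS j : A ^+ j.+1 * E ^+ j.+1 = A * E.
Proof. by rewrite exprS -mulrA exp_mul_expS. Qed.

Lemma mul_expS_stable j : (k <= j)%N -> E * A ^+ j.+1 = A ^+ j.
Proof. by move=> /subnKC <-; rewrite -addSn !exprD mulrA EAkS. Qed.

(** The case [j = k] makes [A * E] act as the identity on [A ^+ k * S]; it maps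
    into this right ideal by [expS_mul_expS]. *)
Lemma proj_exp_stable j : (k <= j)%N -> A * E * A ^+ j = A ^+ j.
Proof.
move=> kj; rewrite -{1}(mul_expS_stable kj) mulrA -(mulrA A) AEE.
exact: mul_expS_stable.
Qed.

(** [E] cancels a factor [A] in front of any element of [A ^+ k * S], and [E]
    belongs to this right ideal. For [j = 0] this says that [E] is an outer
    inverse of [A]. *)
Lemma mul_expS_mulK j : E * (A ^+ j.+1 * E) = A ^+ j * E.
Proof.
have shift i : A ^+ i * E = A ^+ (i + k) * E ^+ k.+1.
  by rewrite exprD -mulrA exp_mul_expS.
by rewrite !shift addSn mulrA mul_expS_stable ?leq_addl.
Qed.

End Words.

Lemma mxindex_gt0 (F : fieldType) n (A : 'M[F]_n) : (0 < mxindex A)%N.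
Proof. by rewrite /mxindex; case: ex_minnP => j /andP[]. Qed.

Section Formulas.
Variables (C : numClosedFieldType) (n : nat) (A : 'M[C]_n).

Let k := mxindex A.
Let E := core_EPinv A.

Let EAkS : E * A ^+ k.+1 = A ^+ k.
Proof. by have [] := is_core_EPinv_eqs (core_EPinvP A). Qed.

Let AEE : A * (E * E) = E.
Proof. by have [] := is_core_EPinv_eqs (core_EPinvP A). Qed.

Let AE_herm : (A * E)^t* = A * E.
Proof. by have [] := is_core_EPinv_eqs (core_EPinvP A). Qed.

(** The equations of the WG inverse leave no choice: [X = E (A X)] since [X]
    lies in the range of [A ^+ k], and [A X = E A]. *)
Lemma wginvE : wginv A = E * E * A.
Proof.
have AX : A * (E * E * A) = E * A by rewrite mulrA AEE.
apply/esym/wginv_unique; split; rewrite mulmxE; last exact: AX.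
have EAE : E * (A * E) = E by rewrite -[A]expr1 (mul_expS_mulK EAkS AEE) mul1r.
by rewrite expr2 mulrA AX -!mulrA (mulrA A) (mulrA E (A * E)) EAE.
Qed.

(** The projector does not depend on [j] because the powers [A ^+ j], for
    [k <= j], all have the same column space. *)
Lemma mul_mpinv_exp j : (k <= j)%N -> A ^+ j * mpinv (A ^+ j) = A * E.
Proof.
case: j => [|j] kj; first by have := leq_trans (mxindex_gt0 A) kj.
rewrite -(expS_mul_expS AEE j).
apply: mulmx_mpinv_proj; rewrite mulmxE (expS_mul_expS AEE) //.
exact: proj_exp_stable EAkS AEE _ kj.
Qed.

Lemma coreinv_exp j : (k <= j)%N -> coreinv (A ^+ j) = E ^+ j.
Proof.
move=> kj; apply/esym/coreinv_unique.
  by rewrite -(subnKC kj) mxindex_exp.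
case: j kj => [|j] kj; first by have := leq_trans (mxindex_gt0 A) kj.
split.
  by rewrite mulmxE mul_mpinv_exp // (expS_mul_expS AEE).
(* [E ^+ j.+1] factors on the left through [E], hence through [A ^+ j.+1]. *)
by rewrite exprS -[X in X * _](exp_mul_expS AEE j.+1) -mulrA trmx_mul submxMl.
Qed.

(** [E * E] removes two of the three factors [A] on either side, so both
    products of the Penrose equations are the Hermitian projector [A * E]. *)
Lemma mpinv_cube_core_EPinv : mpinv (A ^+ 3 * E) = E * E.
Proof.
have cancelE := mul_expS_mulK EAkS AEE.
have MZ : A ^+ 3 * E * (E * E) = A * E.
  by rewrite -mulrA -[E * _]/(E ^+ 3) (expS_mul_expS AEE).
have ZM : E * E * (A ^+ 3 * E) = A * E by rewrite -mulrA !cancelE expr1.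
apply/esym/mpinv_unique; split; rewrite !mulmxE ?MZ ?ZM //.
- have -> : A ^+ 3 * E = A ^+ (3 + k) * E ^+ k.+1.
    by rewrite exprD -mulrA (exp_mul_expS AEE).
  by rewrite mulrA (proj_exp_stable EAkS AEE) ?leq_addl.
- by rewrite !mulrA -(mulrA A) AEE.
Qed.

End Formulas.

Theorem theorem3p4 (R : realType) (n k : nat) (A : 'M[R[i]]_n) :
  mxindex A = k ->
  wginv A = A ^+ k *m coreinv (A ^+ (k + 2)) *m A /\
  wginv A = mpinv (A ^+ 2 *m (A ^+ k *m mpinv (A ^+ k))) *m A.
Proof.
move=> <-; have [_ AEE _] := is_core_EPinv_eqs (core_EPinvP A).
rewrite wginvE !mulmxE; split; congr (_ * A).
  rewrite coreinv_exp ?leq_addr // addn2.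
  by rewrite exprSr mulrA (exp_mul_expS AEE).
by rewrite mul_mpinv_exp // mulrA -exprSr mpinv_cube_core_EPinv.
Qed.
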